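(* Let $V$ be a finite dimensional vector space with ordered basis $v_1<\dots<v_d$. Every Lie bracket expression in $v_1,\dots,v_d$ (i.e. every iterated bracket of the generators $v_1,\dots,v_d$ in the free Lie algebra $\mathrm{L}V$), when written in terms of the configuration basis $(\mathcal{L}\omega)_{\omega\in\mathcal{B}}$ of $\mathrm{L}V$, has integer coefficients.
   Context: **Words.** $\mathcal{A}$ is the set of finite nonempty words in the ordered alphabet $v_1<\dots<v_d$, with lexicographic order (a proper prefix is smaller). $\mathcal{B}\subset\mathcal{A}$ is the set of Lyndon-Shirshov words: words strictly smaller than all their nontrivial cyclic rotations. A simple word in an alphabet is a word $x^k y_1\cdots y_\ell$ with $k,\ell>0$ and $y_i\ne x$ for all $i$; two simple words are compatible if their initial letters $x$ coincide. $\mathcal{A}_0$ is the set of one-letter words, $\mathcal{A}_1$ the set of simple words, and, for $m>1$, $\mathcal{A}_m$ is the set of words which are simple words in an alphabet of mutually compatible elements of $\mathcal{A}_{m-1}$. The $\mathcal{A}_m$ are disjoint, and for $m\ge1$ an element of $\mathcal{A}_m$ is uniquely of the form $\omega^k\psi_1\cdots\psi_\ell$ with $\omega,\psi_i\in\mathcal{A}_{m-1}$ (mutually compatible if $m>1$), $\psi_i\neq\omega$, $k,\ell>0$. Put $\mathcal{B}_m=\mathcal{B}\cap\mathcal{A}_m$; every word of $\mathcal{B}$ lies in exactly one $\mathcal{B}_m$, and if $\omega^k\psi_1\cdots\psi_\ell\in\mathcal{B}_m$ then $\omega,\psi_i\in\mathcal{B}_{m-1}$. **Configuration basis.** $\mathcal{L}v_i=v_i$,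 and for $\omega^k\psi_1\cdots\psi_\ell\in\mathcal{B}_m$ ($m\ge1$, written in its unique decomposition with $\omega,\psi_i\in\mathcal{A}_{m-1}$, mutually compatible if $m>1$, $\psi_i\neq\omega$, $k,\ell>0$), $\mathcal{L}(\omega^k\psi_1\cdots\psi_\ell)$ is the left-normed bracket $$[[\cdots[[[\cdots[\mathcal{L}\psi_1,\mathcal{L}\omega],\cdots],\mathcal{L}\omega],\mathcal{L}\psi_2],\cdots],\mathcal{L}\psi_\ell]$$ with $\mathcal{L}\omega$ occurring $k$ times. The family $(\mathcal{L}\omega)_{\omega\in\mathcal{B}}$ is a vector space basis of $\mathrm{L}V$, called the configuration basis. *)

(* Defs.v *)
From HB Require Import structures.
From mathcomp Require Import all_boot all_order all_algebra finmap.
From mathcomp Require Import boolp classical_sets.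

Set Implicit Arguments.
Unset Strict Implicit.
Unset Printing Implicit Defensive.

Import Order.TTheory GRing.Theory.
Local Open Scope ring_scope.

HB.mixin Record Lmodule_isLie (K : fieldType) L of GRing.Lmodule K L := {
  lie : L -> L -> L;
  lie_linearl : forall y, linear (fun x => lie x y);
  lie_linearr : forall x, linear (lie x);
  liexx : forall x, lie x x = 0;
  lie_jacobi : forall x y z,
    lie x (lie y z) + lie y (lie z x) + lie z (lie x y) = 0
}.

#[short(type="lieAlgType")]
HB.structure Definition LieAlgebra (K : fieldType) :=
  {L of GRing.Lmodule K L & Lmodule_isLie K L}.

Definition lie_morphism (K : fieldType) (L M : lieAlgType K)
    (g : {linear L -> M}) : Prop :=
  forall x y, g (lie x y) = lie (g x) (g y).

(* [LV], together with [iota], is the free Lie algebra on the space [V]. *)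
Definition is_free_lie (K : fieldType) (V : lmodType K) (LV : lieAlgType K)
    (iota : {linear V -> LV}) : Prop :=
  forall (M : lieAlgType K) (f : {linear V -> M}),
    exists g : {linear LV -> M},
      [/\ lie_morphism g,
          forall x, g (iota x) = f x
        & forall h : {linear LV -> M},
            lie_morphism h -> (forall x, h (iota x) = f x) ->
            forall z, h z = g z].

(* The letter v_i is represented by its index i : 'I_d. The words considered
   below are all nonempty, by construction. *)
Definition word (d : nat) := seq 'I_d.

Definition lex_lt (d : nat) (u w : word d) : bool :=
  ((u : seqlexi 'I_d) < (w : seqlexi 'I_d))%O.

Definition lyndon (d : nat) (w : word d) : bool :=
  (w != [::]) && all (fun i => lex_lt w (rot i w)) (iota 1 (size w).-1).

Definition lyndon_word (d : nat) := {w : word d | lyndon w}.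

Definition concat_simple (d : nat) (x : word d) (k : nat) (ys : seq (word d)) :
    word d :=
  flatten (nseq k x ++ ys).

(* w = x^k y_1 ... y_l is a simple word in the alphabet [P], whose letters are
   themselves words over v_1, ..., v_d. *)
Definition simple_in (d : nat) (P : word d -> Prop)
    (w x : word d) (k : nat) (ys : seq (word d)) : Prop :=
  [/\ w = concat_simple x k ys, (0 < k)%N, ys <> [::], P x
    & forall y, y \in ys -> P y /\ y <> x].

(* [decomp m w x k ys]: w is an element of A_(m+1), with decomposition
   w = x^k y_1 ... y_l into elements of A_m. For m > 0 these elements are
   mutually compatible, i.e. they share their initial letter t in A_(m-1). *)
Fixpoint decomp (d m : nat) (w x : word d) (k : nat) (ys : seq (word d)) :
    Prop :=
  match m with
  | 0 => simple_in (fun y => size y = 1%N) w x k ys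
  | m'.+1 => exists t : word d,
      simple_in (fun y => exists j zs, decomp m' y t j zs) w x k ys
  end.

Definition level_set (d m : nat) (w : word d) : Prop :=
  match m with
  | 0 => size w = 1%N
  | m'.+1 => exists x k ys, decomp m' w x k ys
  end.

(* The m with w in A_m; the default value is irrelevant for Lyndon words. *)
Definition level (d : nat) (w : word d) : nat :=
  xget 0%N [set m | level_set m w]%classic.

(* The decomposition (x, k, ys) of w in A_(m+1); the default value is
   irrelevant outside A_(m+1). *)
Definition decomposition (d m : nat) (w : word d) :
    word d * nat * seq (word d) :=
  xget ([::], 0%N, [::]) [set p | decomp m w p.1.1 p.1.2 p.2]%classic.

Section Configuration.
Variables (K : fieldType) (L : lieAlgType K) (d : nat) (gen : 'I_d -> L).

Fixpoint config_at (m : nat) (w : word d) : L :=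
  match m with
  | 0 => if w is i :: _ then gen i else 0
  | m'.+1 =>
      let: (x, k, ys) := decomposition m' w in
      if ys is y1 :: ys' then
        foldl lie (config_at m' y1)
          (nseq k (config_at m' x) ++ map (config_at m') ys')
      else 0
  end.

Definition config (w : word d) : L := config_at (level w) w.

Definition config_comb (c : {fsfun lyndon_word d -> K with 0}) : L :=
  \sum_(w <- finsupp c) c w *: config (val w).

End Configuration.

Inductive bracket_expr (d : nat) : Type :=
  | Gen (i : 'I_d)
  | Bracket (e1 e2 : bracket_expr d).

Fixpoint eval_expr (K : fieldType) (L : lieAlgType K) (d : nat)
    (gen : 'I_d -> L) (e : bracket_expr d) : L :=
  match e with
  | Gen i => gen i
  | Bracket e1 e2 => lie (eval_expr gen e1) (eval_expr gen e2)
  end.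

(* Main.v *)
Require Import Defs.
From HB Require Import structures.
From mathcomp Require Import all_boot all_order all_algebra finmap.
From mathcomp Require Import boolp classical_sets.

Set Implicit Arguments.
Unset Strict Implicit.
Unset Printing Implicit Defensive.

Import Order.TTheory GRing.Theory.
Local Open Scope ring_scope.

(* Spanning over the integers is Lazard elimination: the Lie ring generated by
   an alphabet with least letter x is the sum of Z x, of the Lie ring generated
   by the other letters, and of the Lie ring generated by the configuration
   brackets of the simple words x^k y_1 ... y_l, which form the next alphabet.
   The words of each alphabet stay Lyndon, the number of letters used drops when
   passing to the next alphabet, and a one-letter word is a configuration
   bracket.

   For linear independence, the free Lie algebra is mapped to matrices that act
   on words by right multiplication with letters. There, for w Lyndon, the
   image of the bracket of w is a nonzero multiple of w plus a combination of
   lexicographically larger words of the same length: every Lyndon word is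
   obtained by iterating the parsing into simple words, and at each step the
   leading word of a commutator [A, B] is the smaller of the two products of
   leading words. *)

(** * Lexicographic order and Lyndon words *)

Section Words.
Variable d : nat.
Implicit Types (u v w a b c r : word d).


Lemma lex_lt_trans : transitive (@lex_lt d).
Proof. by move=> v u w; apply: lt_trans. Qed.

Lemma lex_ltxx u : lex_lt u u = false.
Proof. exact: ltxx. Qed.

Lemma lex_lt_gtF u v : lex_lt u v -> lex_lt v u = false.
Proof.
by move=> uv; apply/negP => vu; have := lex_lt_trans uv vu; rewrite lex_ltxx.
Qed.

Lemma lex_lt_total u v : [\/ lex_lt u v, u = v | lex_lt v u].
Proof.
rewrite /lex_lt; case: (ltgtP (u : seqlexi 'I_d) v) => uv.
- by apply: Or31.
- by apply: Or33.
- by apply: Or32.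
Qed.

Lemma lex_lt_cons (i j : 'I_d) u v :
  lex_lt (i :: u) (j :: v) = (i < j)%N || (i == j) && lex_lt u v.
Proof.
rewrite /lex_lt ltxi_cons !leEord.
case: (ltngtP i j) => // ij; first by rewrite -val_eqE /= gtn_eqF.
by rewrite (val_inj ij) eqxx.
Qed.

Lemma lex_ltx0 u : lex_lt u [::] = false.
Proof. by rewrite /lex_lt ltxis0. Qed.

Lemma lex_lt0x u : lex_lt [::] u = (u != [::]).
Proof. by case: u => // i u. Qed.

Lemma lex_lt_cat2l c u v : lex_lt (c ++ u) (c ++ v) = lex_lt u v.
Proof. by elim: c => //= i c IHc; rewrite lex_lt_cons ltnn eqxx. Qed.

(** Either [u] runs out first, or a position carrying two different letters decides; in the second
    case appended tails have no effect. *)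
Lemma lex_ltP u v : lex_lt u v ->
  (exists2 r, r != [::] & v = u ++ r) \/
  (forall a b, lex_lt (u ++ a) (v ++ b)).
Proof.
elim: u v => [|i u IHu] [|j v]; rewrite ?lex_ltx0 //.
  by move=> _; left; exists (j :: v).
rewrite lex_lt_cons => /orP[ij|/andP[/eqP <- /IHu[[r r0 ->]|uv]]].
- by right=> a b; rewrite /= lex_lt_cons ij.
- by left; exists r.
- by right=> a b; rewrite /= lex_lt_cons ltnn eqxx uv.
Qed.

Lemma lex_lt_catr u v a b :
  (size v <= size u)%N -> lex_lt u v -> lex_lt (u ++ a) (v ++ b).
Proof.
move=> vu /lex_ltP[[r r0 def_v]|]; last exact.
by move: vu; rewrite def_v size_cat -{2}[size u]addn0 leq_add2l leqn0 size_eq0 (negPf r0).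
Qed.

Lemma lyndonP w :
  reflect (w <> [::] /\
    forall a b, a <> [::] -> b <> [::] -> w = a ++ b -> lex_lt w (b ++ a))
  (lyndon w).
Proof.
apply: (iffP andP) => [[w0 /allP wP]|[w0 wP]]; split; first exact/eqP.
- move=> a b /eqP a0 /eqP b0 def_w.
  have -> : b ++ a = rot (size a) w by rewrite def_w rot_size_cat.
  apply: wP; rewrite mem_iota lt0n size_eq0 a0 /= add1n.
  rewrite prednK ?lt0n ?size_eq0 //.
  by rewrite def_w size_cat -{1}[size a]addn0 ltn_add2l lt0n size_eq0.
- exact/eqP.
- apply/allP => i; rewrite mem_iota add1n prednK;
    last by rewrite lt0n size_eq0; apply/eqP.
  case/andP=> i0 iw; apply: wP; last by rewrite cat_take_drop.
  + by apply/eqP; rewrite -size_eq0 size_take iw -lt0n.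
  + by apply/eqP; rewrite -size_eq0 size_drop subn_eq0 -ltnNge.
Qed.

(** A suffix [b] below [w] by a difference of letters would put the rotation [ba] below [w]. If
    instead [w = bc], then [bc < ba] gives [c < a] with equal lengths, so the rotation [cb] falls
    below [ab = w]. *)
Lemma lyndon_lt_suffix w a b :
  lyndon w -> a <> [::] -> b <> [::] -> w = a ++ b -> lex_lt w b.
Proof.
move=> /lyndonP[w0 wP] a0 b0 def_w.
have w_ba := wP a b a0 b0 def_w.
have sz_bw : (size b <= size w)%N by rewrite def_w size_cat leq_addl.
have [//|wb|/lex_ltP[[c c0 def_w']|bw]] := lex_lt_total w b.
- have /eqP := congr1 size def_w; rewrite wb size_cat -[X in X == _]add0n.
  by rewrite eqn_add2r eq_sym size_eq0 => /eqP.
- have sz_ca : size c = size a.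
    apply/eqP; rewrite -(eqn_add2l (size b)) -(size_cat b c) -def_w' def_w.
    by rewrite size_cat addnC.
  have ca : lex_lt c a by move: w_ba; rewrite {1}def_w' lex_lt_cat2l.
  have c0' : c <> [::] by apply/eqP.
  have := wP b c b0 c0' def_w'; rewrite {1}def_w => /lex_lt_gtF.
  by rewrite lex_lt_catr ?sz_ca.
- by move: (bw a [::]); rewrite cats0 (lex_lt_gtF w_ba).
Qed.

Lemma lt_suffix_lyndon w : w <> [::] ->
  (forall a b, a <> [::] -> b <> [::] -> w = a ++ b -> lex_lt w b) -> lyndon w.
Proof.
move=> w0 wP; apply/lyndonP; split=> // a b a0 b0 def_w.
rewrite -[w]cats0; apply: lex_lt_catr; last exact: wP def_w.
by rewrite def_w size_cat leq_addl.
Qed.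

Lemma lyndon_neq0 w : lyndon w -> w <> [::].
Proof. by case/lyndonP. Qed.

(** First [uv < v]. A proper suffix of [uv] is then either a suffix of [v], hence at least [v], or a
    proper suffix of [u] followed by [v]; the latter exceeds [uv] because the suffix of [u] is
    larger than [u] and shorter. *)
Lemma lyndon_cat u v : lyndon u -> lyndon v -> lex_lt u v -> lyndon (u ++ v).
Proof.
move=> uL vL uv; have [u0 v0] := (lyndon_neq0 uL, lyndon_neq0 vL).
have uv_v : lex_lt (u ++ v) v.
  have [[r /eqP r0 def_v]|uv'] := lex_ltP uv;
    last by rewrite -[v in X in lex_lt _ X]cats0.
  by rewrite {2}def_v lex_lt_cat2l (lyndon_lt_suffix vL u0 r0 def_v).
apply: lt_suffix_lyndon => [|a b a0 b0 uv_ab]; first by case: (u) u0.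
have [ua|ua] := leqP (size u) (size a).
  have def_v : v = drop (size u) a ++ b.
    rewrite -[LHS](drop_size_cat v (erefl (size u))) uv_ab drop_cat.
    by move: ua; rewrite leq_eqVlt => /orP[/eqP ->|->//];
      rewrite ltnn subnn drop0 drop_size.
  case: (drop (size u) a) def_v => [def_v|i c def_v]; first by rewrite -[b]def_v.
  by apply: lex_lt_trans uv_v _; apply: lyndon_lt_suffix def_v.
have def_u : u = a ++ take (size u - size a) b.
  rewrite -[LHS](take_size_cat v (erefl (size u))) uv_ab take_cat.
  by rewrite ltnNge (ltnW ua).
have def_b : b = take (size u - size a) b ++ v.
  have /eqP := uv_ab; rewrite {1}def_u -catA eqseq_cat // eqxx /=.
  by move/eqP => ->.
have c0 : take (size u - size a) b <> [::].
  by move=> c0; move: ua; rewrite def_u c0 cats0 ltnn.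
rewrite def_b; apply: lex_lt_catr; last exact: lyndon_lt_suffix def_u.
by rewrite [X in (_ <= size X)%N]def_u size_cat leq_addl.
Qed.

(** The rotation [xxw] forces [wx < xw], which puts the rotation [wxx] below [xwx]. *)
Lemma lyndon_unbordered x w : x <> [::] -> lyndon (x ++ w ++ x) = false.
Proof.
move=> x0; apply/negP => /lyndonP[_ wP].
have wx0 : w ++ x <> [::] by case: (w).
have xw0 : x ++ w <> [::] by case: (x) x0.
have := wP (x ++ w) x xw0 x0; rewrite -catA lex_lt_cat2l => /(_ erefl) wx_xw.
have := wP x (w ++ x) x0 wx0 erefl; rewrite catA => /lex_lt_gtF.
by rewrite lex_lt_catr // !size_cat addnC.
Qed.

End Words.

(** * Uniqueness of the parsing into simple words *)

Section Parsing.

Definition simple_seq (T : eqType) (x : T) (b : seq T) : Prop :=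
  exists k ys, [/\ b = nseq k x ++ ys, (0 < k)%N, ys <> [::] & x \notin ys].

Lemma flatten_flatten (T : Type) (SS : seq (seq (seq T))) :
  flatten (flatten SS) = flatten (map flatten SS).
Proof. by elim: SS => //= S SS <-; rewrite flatten_cat. Qed.

Lemma simple_seq_head (T : eqType) (x : T) b :
  simple_seq x b -> exists b', b = x :: b'.
Proof. by case=> [[|k] [ys [-> //]]] _ _ _; eexists. Qed.

Lemma simple_seq_size (T : eqType) (x : T) b : simple_seq x b -> (1 < size b)%N.
Proof.
case=> [k [[|y ys] [-> k0 // _ _]]].
by rewrite size_cat size_nseq /= addnS ltnS (leq_trans k0) ?leq_addr.
Qed.

Lemma size_flatten_simple (T : eqType) (x : T) S :
  (forall b, b \in S -> simple_seq x b) ->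
  (size S + size S <= size (flatten S))%N.
Proof.
elim: S => //= b S IHS simS; rewrite size_cat.
rewrite addSn addnS -[X in (X <= _)%N]add2n leq_add //.
  exact: simple_seq_size (simS b (mem_head _ _)).
by rewrite IHS // => c cS; apply: simS; rewrite inE cS orbT.
Qed.

(** Both exponents are read off from the word: the run of [x] ends at the first other letter, and
    the block ends where [x] reappears or the word stops. *)
Lemma simple_seq_parse (T : eqType) (x : T) k ys r :
  ys <> [::] -> x \notin ys -> (forall z r', r = z :: r' -> z = x) ->
  find (predC1 x) ((nseq k x ++ ys) ++ r) = k /\
  find (pred1 x) (ys ++ r) = size ys.
Proof.
move=> ys0 xys rx; split.
  rewrite -catA find_cat size_nseq has_nseq /= eqxx andbF.
  case: ys ys0 xys => //= y ys _; rewrite inE negb_or eq_sym => /andP[-> _].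
  by rewrite addn0.
rewrite find_cat has_pred1 (negPf xys).
by case: r rx => [|z r] /= => [_|/(_ z r erefl) ->]; rewrite ?eqxx addn0.
Qed.

Lemma simple_seq_cat_inj (T : eqType) (x : T) b b' r r' :
  simple_seq x b -> simple_seq x b' ->
  (forall z s, r = z :: s -> z = x) -> (forall z s, r' = z :: s -> z = x) ->
  b ++ r = b' ++ r' -> b = b'.
Proof.
move=> [k [ys [-> k0 ys0 xys]]] [k' [ys' [-> k0' ys0' xys']]] rx rx' eq_br.
have [fk fy] := simple_seq_parse k ys0 xys rx.
have [fk' fy'] := simple_seq_parse k' ys0' xys' rx'.
have kk' : k = k' by rewrite -fk eq_br fk'.
move: eq_br; rewrite kk' -!catA => /eqP;
  rewrite eqseq_cat // eqxx /= => /eqP eq_y.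
have szy : size ys = size ys' by rewrite -fy eq_y fy'.
by move/eqP: eq_y; rewrite eqseq_cat // => /andP[/eqP -> _].
Qed.

Lemma flatten_simple_head (T : eqType) (x : T) S :
  (forall b, b \in S -> simple_seq x b) ->
  forall z s, flatten S = z :: s -> z = x.
Proof.
case: S => [|b S] //= bS z s.
by have [b' ->] := simple_seq_head (bS b (mem_head _ _)) => -[].
Qed.

Lemma flatten_simple_inj (T : eqType) (x : T) S S' :
  (forall b, b \in S -> simple_seq x b) ->
  (forall b, b \in S' -> simple_seq x b) ->
  flatten S = flatten S' -> S = S'.
Proof.
elim: S S' => [|b S IHS] [|b' S'] //= bS bS'.
- by have [? ->] := simple_seq_head (bS' b' (mem_head _ _)).
- by have [? ->] := simple_seq_head (bS b (mem_head _ _)).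
have tlS c : c \in S -> simple_seq x c by move=> cS; apply: bS;
  rewrite inE cS orbT.
have tlS' c : c \in S' -> simple_seq x c by move=> cS; apply: bS';
  rewrite inE cS orbT.
move=> eqS; have eqb : b = b'.
  apply: (simple_seq_cat_inj _ _ _ _ eqS);
    by [apply: bS; rewrite mem_head | apply: bS'; rewrite mem_head
       | apply: flatten_simple_head tlS | apply: flatten_simple_head tlS'].
move: eqS; rewrite eqb => /eqP; rewrite eqseq_cat // eqxx /= => /eqP.
by move=> /(IHS _ tlS tlS') ->.
Qed.

Variable d : nat.
Implicit Types (m : nat) (s t w x y : word d).

(* The alphabet of the words of level [m] which, for [m > 0], have initial
   letter [t] in level [m - 1]; [t] is a dummy for [m = 0]. *)
Definition letter_at m t y : Prop :=
  if m is m'.+1 then exists j zs, decomp m' y t j zs else size y = 1%N.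

Lemma decompP m w x k ys :
  decomp m w x k ys <-> exists t, simple_in (letter_at m t) w x k ys.
Proof. by case: m => //=; split=> [|[//]]; exists [::]. Qed.

Lemma level_letter m w : level_set m w -> exists t, letter_at m t w.
Proof. by case: m => //= sz; exists [::]. Qed.

Lemma letter_level m t w : letter_at m t w -> level_set m w.
Proof. by case: m => //= m [j [zs ?]]; exists t, j, zs. Qed.

Lemma simple_in_seq (P : word d -> Prop) w x k ys : simple_in P w x k ys ->
  [/\ w = flatten (nseq k x ++ ys), simple_seq x (nseq k x ++ ys)
    & forall y, y \in nseq k x ++ ys -> P y].
Proof.
case=> -> k0 ys0 Px Pys; split=> //.
  by exists k, ys; split=> //; apply/negP => /Pys[].
by move=> y; rewrite mem_cat mem_nseq => /orP[/andP[_ /eqP -> //]|/Pys[]].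
Qed.

Definition all_at m (S : seq (word d)) : Prop :=
  exists t, forall y, y \in S -> letter_at m t y.

Definition flatten_at_inj m : Prop :=
  forall S S', all_at m S -> all_at m S' -> flatten S = flatten S' -> S = S'.

(** For positive [m] this follows once the initial letter is determined by the word; the formulation
    also covers the dummy [t] at level 0. *)
Definition initial_at_inj m : Prop := forall t t' x y,
  letter_at m t x -> letter_at m t' x -> letter_at m t y -> letter_at m t' y.

Lemma decomp_inj m w x k ys x' k' ys' : flatten_at_inj m ->
  decomp m w x k ys -> decomp m w x' k' ys' -> [/\ x = x', k = k' & ys = ys'].
Proof.
move=> inj /decompP[t /[dup] + /simple_in_seq[def_w _ Pw]].
move=> [_ k0 ys0 _ Pys] /decompP[t' /[dup] + /simple_in_seq[def_w' _ Pw']].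
move=> [_ k0' ys0' _ Pys'].
have eqS := inj _ _ (ex_intro _ t Pw) (ex_intro _ t' Pw') (etrans (esym def_w) def_w').
have xx' : x = x' by move: eqS; case: (k) (k') k0 k0' => [|?] [|?] // _ _ [].
rewrite -{}xx' in eqS Pys' *.
have xys : x \notin ys by apply/negP => /Pys[].
have xys' : x \notin ys' by apply/negP => /Pys'[].
have [fk _] := simple_seq_parse (r := [::]) k ys0 xys ltac:(by []).
have [fk' _] := simple_seq_parse (r := [::]) k' ys0' xys' ltac:(by []).
have kk' : k = k' by rewrite -fk eqS fk'.
move: eqS; rewrite kk' => /eqP; rewrite eqseq_cat // eqxx /= => /eqP eq_y.
by split.
Qed.

(** All words of [S] share the letter [x], so the alphabets of their decompositions, which all
    contain [x], coincide by [initial_at_inj]. *)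
Lemma all_at_expand m S : initial_at_inj m -> all_at m.+1 S ->
  exists x SS, [/\ S = map flatten SS, forall b, b \in SS -> simple_seq x b
    & all_at m (flatten SS)].
Proof.
move=> inj [x xS]; exists x.
have [t tS] : exists t, forall y, y \in S ->
  exists k ys, simple_in (letter_at m t) y x k ys.
  case: S xS => [|y0 S] xS; first by exists [::].
  have [k0 [ys0 /decompP[t [_ _ _ tx _]]]] := xS _ (mem_head _ _).
  exists t => y /xS[k [ys /decompP[t' [-> k1 ys1 t'x Pys]]]].
  exists k, ys; split=> // z /Pys[t'z zx]; split=> //.
  exact: inj t'x tx t'z.
suff [SS [-> simSS SSt]] : exists SS, [/\ S = map flatten SS,
    forall b, b \in SS -> simple_seq x b
  & forall y, y \in flatten SS -> letter_at m t y].
  by exists SS; split=> //; exists t.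
elim: S tS {xS} => [|y S IHS] tS; first by exists [::].
have [|SS [-> simSS SSt]] := IHS; first by move=> z zS; apply: tS;
  rewrite inE zS orbT.
have [k [ys /simple_in_seq[-> sim_y Py]]] := tS y (mem_head _ _).
exists ((nseq k x ++ ys) :: SS); split=> //.
  by move=> b; rewrite inE => /orP[/eqP ->|/simSS].
by move=> z; rewrite /= mem_cat => /orP[/Py|/SSt].
Qed.

Lemma flatten_size1_inj S S' : all_at 0 S -> all_at 0 S' ->
  flatten S = flatten S' -> S = S'.
Proof.
case=> t sS [t' sS']; elim: S S' sS sS' => [|y S IHS] [|y' S'] //= sS sS'.
- by have := sS' y' (mem_head _ _); case: (y').
- by have := sS y (mem_head _ _); case: (y).
have size1 (z : word d) : size z = 1%N -> exists i, z = [:: i].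
  by case: z => [|i []] // _; exists i.
have [i def_y] := size1 y (sS y (mem_head _ _)).
have [i' def_y'] := size1 y' (sS' y' (mem_head _ _)).
rewrite def_y def_y' => -[-> eqS]; rewrite (IHS S') // => z zS.
  by apply: sS; rewrite inE zS orbT.
by apply: sS'; rewrite inE zS orbT.
Qed.

(** Simultaneous induction: two parsings are expanded one level down, where they agree, and are then
    regrouped uniquely into simple sequences. Unique parsing at level [m] also determines the
    initial letters one level up. *)
Lemma parsing_inj m : flatten_at_inj m /\ initial_at_inj m.
Proof.
elim: m => [|m [IHf IHi]]; first by split=> //; apply: flatten_size1_inj.
split=> [S S'|t t' x y].
  move=> /(all_at_expand IHi)[x [SS [-> simS atS]]].
  move=> /(all_at_expand IHi)[x' [SS' [-> simS' atS']]].
  rewrite -!flatten_flatten => /(IHf _ _ atS atS') eqSS.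
  case: SS simS atS eqSS => [|b SS] simS atS eqSS.
    case: SS' simS' eqSS {atS'} => [|b SS'] //= simS'.
    by have [? ->] := simple_seq_head (simS' b (mem_head _ _)).
  case: SS' simS' atS' eqSS => [|b' SS'] simS' atS' eqSS.
    by have [? def_b] := simple_seq_head (simS b (mem_head _ _));
      rewrite def_b in eqSS.
  have [bb def_b] := simple_seq_head (simS b (mem_head _ _)).
  have xx' : x = x'.
    by apply: (flatten_simple_head simS'); rewrite -eqSS def_b.
  by rewrite -xx' in simS'; rewrite (flatten_simple_inj simS simS' eqSS).
move=> [j [zs dx]] [j' [zs' dx']].
by have [->] := decomp_inj IHf dx dx'.
Qed.

Lemma decomp_uniq m w x k ys x' k' ys' :
  decomp m w x k ys -> decomp m w x' k' ys' -> [/\ x = x', k = k' & ys = ys'].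
Proof. exact/decomp_inj/(parsing_inj m).1. Qed.

(** Each descent by one level replaces every letter by at least two, so the number of letters grows
    strictly. *)
Lemma all_at_lower m j S : S <> [::] -> all_at (j.+1 + m) S -> 
  exists S', [/\ all_at m S', flatten S' = flatten S & (size S < size S')%N].
Proof.
have lower1 i T : all_at i.+1 T ->
    exists T', [/\ all_at i T', flatten T' = flatten T & (size T + size T <= size T')%N].
  move=> /(all_at_expand (parsing_inj i).2)[x [SS [-> simS atS]]].
  exists (flatten SS); split; rewrite ?flatten_flatten // size_map.
  exact: size_flatten_simple simS.
elim: j S => [|j IHj] S S0 /lower1[S' [atS' eqS leS]].
  exists S'; split=> //; apply: leq_trans leS.
  by case: (S) S0 => //= ? ? _; rewrite addSn ltnS leq_addl.
have {}leS : (size S <= size S')%N by apply: leq_trans leS; rewrite leq_addr.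
have S0' : S' <> [::].
  by move=> S0'; move: leS; rewrite S0' leqn0 size_eq0 => /eqP.
have [S2 [? eqS2 leS2]] := IHj S' S0' atS'.
by exists S2; rewrite eqS2; split=> //; apply: leq_ltn_trans leS2.
Qed.

Lemma level_uniq m m' w : level_set m w -> level_set m' w -> m = m'.
Proof.
wlog lt_mm : m m' / (m < m')%N => [IH wm wm'|].
  by have [/IH->|/IH->|] := ltngtP m m'.
move=> /level_letter[t tw] /level_letter[t' tw'].
(* Lowered from level [m'] to level [m], [w] becomes a sequence of more than one letter, while [w]
   alone is also a parsing at level [m]. *)
have : all_at ((m' - m.+1).+1 + m) [:: w].
  by rewrite addSnnS subnK //; exists t' => y; rewrite inE => /eqP ->.
case/all_at_lower=> // S' [atS' eqS].
have -> : [:: w] = S'; last by rewrite ltnn.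
apply: (parsing_inj m).1 => //; exists t => y; rewrite inE => /eqP ->; exact: tw.
Qed.

Lemma level_eq m w : level_set m w -> level w = m.
Proof.
move=> wm; rewrite /level; case: xgetP => [m' _ wm'|/(_ m)//].
exact: level_uniq wm' wm.
Qed.

Lemma decomposition_eq m w x k ys :
  decomp m w x k ys -> decomposition m w = (x, k, ys).
Proof.
move=> dw; rewrite /decomposition; case: xgetP => [[[x' k'] ys'] _ /= dw'|].
  by have [-> -> ->] := decomp_uniq dw dw'.
by move=> /(_ (x, k, ys)).
Qed.

Variables (K : fieldType) (L : lieAlgType K) (gen : 'I_d -> L).

Lemma config_letter i : config gen [:: i] = gen i.
Proof. by rewrite /config (@level_eq 0). Qed.

(** The letters of the decomposition have level exactly [m], so the value of [config_at] at [m] on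
    them is [config]. *)
Lemma config_decomp m w x k y ys : decomp m w x k (y :: ys) ->
  config gen w =
    foldl lie (config gen y) (nseq k (config gen x) ++ map (config gen) ys).
Proof.
move=> dw.
rewrite {1}/config (@level_eq m.+1); last by exists x, k, (y :: ys).
rewrite /= (decomposition_eq dw) /=.
have /decompP[t [_ _ _ tx tys]] := dw.
have conf_at z : letter_at m t z -> config_at gen m z = config gen z.
  by move=> /letter_level /level_eq zm; rewrite /config zm.
rewrite conf_at //; last by have [] := tys y (mem_head _ _).
rewrite conf_at //; congr (foldl _ _ (_ ++ _)); apply/eq_in_map => z zys.
by apply: conf_at; have [] := tys z; rewrite ?inE ?zys ?orbT.
Qed.

End Parsing.

(** * Alphabets of Lyndon words *)

Section Alphabets.
Variable d : nat.
Implicit Types (m : nat) (t u v w x y : word d) (S : seq (word d)).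

(* Comparing two words written in the alphabet [S] reduces to comparing their
   first distinct letters, even when one of these is a prefix of the other. *)
Definition separated S : Prop := forall u v a r, u \in S -> v \in S ->
  lex_lt u v -> {subset a <= S} -> lex_lt (u ++ flatten a) (v ++ r).

(** The invariant carried from each alphabet to the next. *)
Definition alphabet m S : Prop :=
  [/\ all_at m S, forall y, y \in S -> lyndon y & separated S].

Definition least_letter S x : Prop :=
  x \in S /\ forall y, y \in S -> y <> x -> lex_lt x y.

Lemma alphabet_sub m S S' : {subset S' <= S} -> alphabet m S -> alphabet m S'.
Proof.
move=> sS [[t tS] yS sepS]; split; first by exists t => y /sS/tS.
  by move=> y /sS/yS.
by move=> u v a r /sS uS /sS vS uv aS; apply: sepS => // y /aS/sS.
Qed.

Lemma alphabet_letters : alphabet 0 [seq [:: i] | i <- enum 'I_d].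
Proof.
split; first by exists [::] => y /mapP[i _ ->].
  by move=> y /mapP[i _ ->].
move=> _ _ a r /mapP[i _ ->] /mapP[j _ ->].
by rewrite !lex_lt_cons lex_ltxx andbF orbF => ->.
Qed.

Lemma seq_compare (T : eqType) (s1 s2 : seq T) :
  [\/ exists r, s2 = s1 ++ r, exists r, s1 = s2 ++ r
    | exists c p q r1 r2, [/\ s1 = c ++ p :: r1, s2 = c ++ q :: r2 & p <> q]].
Proof.
elim: s1 s2 => [|p s1 IHs] [|q s2]; try by [apply: Or31; eexists | apply: Or32;
  eexists].
have [<-|/eqP pq] := eqVneq p q; last by apply: Or33; exists [::], p, q, s1, s2.
have [[r ->]|[r ->]|[c [p' [q' [r1 [r2 [-> -> pq]]]]]]] := IHs s2.
- by apply: Or31; exists r.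
- by apply: Or32; exists r.
- by apply: Or33; exists (p :: c), p', q', r1, r2.
Qed.

Lemma simple_lt S x A y : separated S -> least_letter S x ->
  {subset A <= S} -> y \in S -> y <> x -> lex_lt (flatten (x :: A)) y.
Proof.
move=> sepS [xS xmin] AS yS yx; rewrite -[y]cats0.
by apply: sepS => //; apply: xmin.
Qed.

Lemma pow_cat_lyndon x y k : lyndon x -> lyndon y -> lex_lt x y ->
  lyndon (flatten (nseq k x) ++ y).
Proof.
move=> xL yL xy; elim: k => //= k IHk.
rewrite -catA; apply: lyndon_cat => //.
case: k {IHk} => [|k] //=; rewrite -[x in X in lex_lt X _]cats0 -catA.
rewrite lex_lt_cat2l lex_lt0x -size_eq0 size_cat addn_eq0 !size_eq0 negb_and.
by apply/orP; right; apply/eqP/lyndon_neq0.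
Qed.

(** Letters after the run of [x] are appended one by one: the word built so far starts with [x],
    hence is smaller than the next letter, and [lyndon_cat] applies. *)
Lemma simple_lyndon m S x b : alphabet m S -> least_letter S x ->
  {subset b <= S} -> simple_seq x b -> lyndon (flatten b).
Proof.
move=> [_ lynS sepS] xleast bS [k [ys [def_b]]]; have [xS xmin] := xleast.
rewrite {}def_b in bS *; elim/last_ind: ys bS => // ys y IHys bS k0 _.
rewrite mem_rcons inE negb_or => /andP[/eqP xy xys].
have yS : y \in S by apply: bS; rewrite mem_cat mem_rcons mem_head orbT.
have {}bS : {subset nseq k x ++ ys <= S}.
  move=> z; rewrite mem_cat => zb; apply: bS.
  by rewrite mem_cat mem_rcons inE orbCA zb orbT.
have yx : y <> x by move=> yx; apply: xy.
rewrite -cats1 catA flatten_cat /= cats0.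
have [ys0|/eqP ys0] := eqVneq ys [::].
  by rewrite ys0 cats0; apply: pow_cat_lyndon; rewrite ?lynS ?xmin.
apply: lyndon_cat; [exact: IHys | exact: lynS |].
case: k k0 bS {IHys} => // k _ bS; apply: (simple_lt sepS) => // z zb.
by apply: bS; rewrite inE zb orbT.
Qed.

Lemma simple_decomp m S x k ys : alphabet m S -> {subset nseq k x ++ ys <= S} ->
  (0 < k)%N -> ys <> [::] -> x \notin ys ->
    decomp m (flatten (nseq k x ++ ys)) x k ys.
Proof.
move=> [[t tS] _ _] bS k0 ys0 xys; apply/decompP; exists t; split=> //.
  by apply/tS/bS; rewrite mem_cat mem_nseq k0 eqxx.
move=> y yys; split; first by apply/tS/bS; rewrite mem_cat yys orbT.
by move=> yx; rewrite -yx yys in xys.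
Qed.

Lemma flatten_simple_over S x (SS : seq (seq (word d))) a :
  (forall b, b \in SS -> simple_seq x b /\ {subset b <= S}) ->
  {subset a <= map flatten SS} ->
  exists2 A, {subset A <= S} & flatten a = flatten A /\ (A <> [::] ->
    exists A', A = x :: A').
Proof.
move=> simSS; elim: a => [|y a IHa] aSS; first by exists [::].
have /mapP[b /simSS[simb bS] ->] := aSS y (mem_head _ _).
have [|A AS [eqA _]] := IHa; first by move=> z za; apply: aSS;
  rewrite inE za orbT.
exists (b ++ A); first by move=> z; rewrite mem_cat => /orP[/bS|/AS].
rewrite /= eqA flatten_cat; split=> // _.
by have [b' ->] := simple_seq_head simb; exists (b' ++ A).
Qed.

(** [U] and [V] are compared as sequences over [S]. If they differ at some letter, separation of [S]
    decides. If [V] extends [U], its next letter is larger than [x], whereas anything written after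
    [U] starts with [x]. *)
Lemma separated_simple S x (SS : seq (seq (word d))) :
  (forall y, y \in S -> lyndon y) -> separated S -> least_letter S x ->
  (forall b, b \in SS -> simple_seq x b /\ {subset b <= S}) ->
  separated (map flatten SS).
Proof.
move=> lynS sepS [xS xmin] simSS _ _ a r /mapP[U USS ->] /mapP[V VSS ->] UV aSS.
have [[simU US] [simV VS]] := (simSS U USS, simSS V VSS).
have [A AS [-> A0]] := flatten_simple_over simSS aSS.
have [[B def_V]|[B def_U]|[c [p [q [r1 [r2 [def_U def_V pq]]]]]]] := seq_compare U V.
- case: B def_V => [|b B] def_V.
    by move: UV; rewrite def_V cats0 lex_ltxx.
  have bS : b \in S by apply: VS; rewrite def_V mem_cat mem_head orbT.
  have bx : b <> x.
    (* If [V] continued [U] by [x], the block [U] would already be complete there, so unique parsing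
       would give [V = U]. *)
    move=> bx; have eqVU : V ++ [::] = U ++ b :: B by rewrite cats0.
    have VU : V = U.
      by apply: (simple_seq_cat_inj simV simU _ _ eqVU) => // z s [<- _].
    by move/(congr1 size): def_V; rewrite VU size_cat => /eqP;
      rewrite -[X in X == _]addn0 eqn_add2l.
  rewrite def_V flatten_cat -!catA lex_lt_cat2l.
  case: A AS A0 => [|x' A] AS A0.
    rewrite lex_lt0x -size_eq0 size_cat addn_eq0 size_eq0 negb_and.
    by apply/orP; left; apply/eqP/lyndon_neq0/lynS.
  have [//|A' [-> defA']] := A0; apply: sepS => //; first exact: xmin.
  by move=> z zA; apply: AS; rewrite inE zA orbT.
- by move: UV; rewrite def_U flatten_cat -[X in lex_lt _ X]cats0 lex_lt_cat2l lex_ltx0.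
have pS : p \in S by apply: US; rewrite def_U mem_cat mem_head orbT.
have qS : q \in S by apply: VS; rewrite def_V mem_cat mem_head orbT.
have r1S : {subset r1 <= S}.
  by move=> z zr; apply: US; rewrite def_U mem_cat inE zr !orbT.
have r2S : {subset r2 <= S}.
  by move=> z zr; apply: VS; rewrite def_V mem_cat inE zr !orbT.
have flat_cons z s : flatten (c ++ z :: s) = flatten c ++ (z ++ flatten s).
  by rewrite flatten_cat.
rewrite def_U def_V !flat_cons -!(catA (flatten c)) lex_lt_cat2l.
rewrite -!catA -flatten_cat.
have [pq'|//|qp] := lex_lt_total p q.
  by apply: sepS => // z; rewrite mem_cat => /orP[/r1S|/AS].
move: UV; rewrite def_U def_V !flat_cons lex_lt_cat2l.
by rewrite lex_lt_gtF //; apply: sepS.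
Qed.

Lemma alphabet_simple m S x (SS : seq (seq (word d))) :
  alphabet m S -> least_letter S x ->
  (forall b, b \in SS -> simple_seq x b /\ {subset b <= S}) ->
  alphabet m.+1 (map flatten SS).
Proof.
move=> alphS xleast simSS; have [_ lynS sepS] := alphS; split.
- exists x => _ /mapP[b /simSS[[k [ys [def_b k0 ys0 xys]]] bS] ->].
  by exists k, ys; rewrite def_b in bS *; apply: (simple_decomp alphS).
- by move=> _ /mapP[b /simSS[simb bS] ->]; apply: (simple_lyndon alphS xleast bS).
- exact: (separated_simple lynS sepS xleast simSS).
Qed.

Lemma least_letter_ex S : S <> [::] -> exists x, least_letter S x.
Proof.
elim: S => // y S IHS _; case: S IHS => [_|z S IHS].
  by exists y; split; rewrite ?mem_head // => z; rewrite inE => /eqP.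
have [//|x [xS xmin]] := IHS.
have [xy|xy|yx] := lex_lt_total x y.
- exists x; split=> [|u]; first by rewrite inE xS orbT.
  by rewrite inE => /orP[/eqP ->|/xmin].
- exists x; split=> [|u]; first by rewrite inE xS orbT.
  by rewrite inE => /orP[/eqP -> []|/xmin].
- exists y; split=> [|u]; first exact: mem_head.
  rewrite inE => /orP[/eqP //|uS] _.
  by have [->//|/eqP/(xmin u uS)] := eqVneq u x; apply: lex_lt_trans.
Qed.

End Alphabets.

(** * Lazard elimination *)

Section LieSpan.
Variables (K : fieldType) (L : lieAlgType K).
Implicit Types (a b c x y z : L) (n : nat).

Lemma lieDl x y z : lie (x + y) z = lie x z + lie y z.
Proof. by have := lie_linearl z 1 x y; rewrite !scale1r. Qed.

Lemma lieDr x y z : lie z (x + y) = lie z x + lie z y.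
Proof. by have := lie_linearr z 1 x y; rewrite !scale1r. Qed.

Lemma lie0l z : lie 0 z = 0 :> L.
Proof. by have /eqP := lieDl 0 0 z;
  rewrite addr0 -subr_eq subrr eq_sym => /eqP. Qed.

Lemma lie0r z : lie z 0 = 0 :> L.
Proof. by have /eqP := lieDr 0 0 z;
  rewrite addr0 -subr_eq subrr eq_sym => /eqP. Qed.

Lemma lieZl (k : K) x z : lie (k *: x) z = k *: lie x z.
Proof. by have := lie_linearl z k x 0; rewrite /= lie0l !addr0. Qed.

Lemma lieZr (k : K) x z : lie z (k *: x) = k *: lie z x.
Proof. by have := lie_linearr z k x 0; rewrite /= lie0r !addr0. Qed.

Lemma lieBl x y z : lie (x - y) z = lie x z - lie y z.
Proof. by rewrite lieDl -scaleN1r lieZl scaleN1r. Qed.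

Lemma lieBr x y z : lie z (x - y) = lie z x - lie z y.
Proof. by rewrite lieDr -scaleN1r lieZr scaleN1r. Qed.

Lemma lie_anti x y : lie x y = - lie y x.
Proof.
apply/eqP; rewrite -addr_eq0; apply/eqP.
by have := liexx (x + y); rewrite lieDl !lieDr !liexx addr0 add0r.
Qed.

Lemma lie_jacobil x y z : lie (lie x y) z = lie (lie x z) y + lie x (lie y z).
Proof.
have /eqP := lie_jacobi x y z.
rewrite (lie_anti z (lie x y)) subr_eq0 => /eqP <-.
by rewrite addrC (lie_anti z x) -scaleN1r lieZr scaleN1r -lie_anti.
Qed.

Lemma lie_jacobir x y z : lie z (lie x y) = lie (lie z x) y - lie (lie z y) x.
Proof. by rewrite (lie_jacobil z x y) [X in X - _]addrC addrK. Qed.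

(* The elements of weight at most [n] of the Lie ring generated by [G], where
   [G k] are the generators of weight [k]. *)
Inductive lie_span (G : nat -> L -> Prop) : nat -> L -> Prop :=
  | Lie_span_gen n z : G n z -> lie_span G n z
  | Lie_span0 n : lie_span G n 0
  | Lie_spanB n x y : lie_span G n x -> lie_span G n y -> lie_span G n (x - y)
  | Lie_span_lie n m x y :
      lie_span G n x -> lie_span G m y -> lie_span G (n + m) (lie x y)
  | Lie_span_le n m z : (n <= m)%N -> lie_span G n z -> lie_span G m z.

Section Closure.
Variable G : nat -> L -> Prop.

Lemma lie_spanN n z : lie_span G n z -> lie_span G n (- z).
Proof. by rewrite -[- z]add0r; apply: Lie_spanB; apply: Lie_span0. Qed.

Lemma lie_spanD n x y : lie_span G n x -> lie_span G n y -> lie_span G n (x + y).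
Proof. by move=> Gx Gy; rewrite -[y]opprK; apply/Lie_spanB/lie_spanN. Qed.

Lemma lie_span_int n (i : int) z : lie_span G n z -> lie_span G n (i%:~R *: z).
Proof.
move=> Gz; rewrite scaler_int.
have Gzn k : lie_span G n (z *+ k).
  elim: k => [|k IHk]; first by rewrite mulr0n; apply: Lie_span0.
  by rewrite mulrS; apply: lie_spanD.
by case: i => k; [apply: Gzn | apply/lie_spanN/Gzn].
Qed.

Lemma lie_span_sub (G' : nat -> L -> Prop) n z :
  (forall k x, G k x -> lie_span G' k x) -> lie_span G n z -> lie_span G' n z.
Proof.
move=> GG'; elim=> {n z} [n z /GG'//|n|n x y _ Gx _|n m x y _ Gx _|n m z nm _].
- exact: Lie_span0.
- exact: Lie_spanB.
- exact: Lie_span_lie.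
- exact: Lie_span_le.
Qed.

End Closure.

Section Elimination.
Variables (X : L) (Y : L -> Prop).

Let GY n z := n = 1%N /\ Y z.

(* The brackets [..[[y, X], .., X], y_1], .., y_l] with at least one [X]. *)
Let GB n z := exists k y ys, [/\ z = foldl lie y (nseq k.+1 X ++ ys), Y y,
  forall y', y' \in ys -> Y y' & n = (k + size ys).+2].

(** Bracketing a generator with [y] only lengthens its list [ys]; the Jacobi identity extends this
    to brackets. *)
Let spanB_lieY n c y : Y y -> lie_span GB n c -> lie_span GB n.+1 (lie c y).
Proof.
move=> Yy; elim=> {n c} [n z|n|n a b _ Ga _ Gb|n m a b Ga GLa Gb GLb|n m z nm _].
- move=> [k [y0 [ys [-> Yy0 Yys ->]]]]; apply: Lie_span_gen.
  exists k, y0, (rcons ys y); split=> //.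
  + by rewrite -rcons_cat foldl_rcons.
  + by move=> y'; rewrite mem_rcons inE => /orP[/eqP ->|/Yys].
  + by rewrite size_rcons addnS.
- by rewrite lie0l; apply: Lie_span0.
- by rewrite lieBl; apply: Lie_spanB.
- rewrite lie_jacobil; apply: lie_spanD; first by rewrite -addSn;
    apply: Lie_span_lie.
  by rewrite -addnS; apply: Lie_span_lie.
- by apply: Lie_span_le; rewrite ltnS.
Qed.

Let spanB_spanY n m c b :
  lie_span GY m b -> lie_span GB n c -> lie_span GB (n + m) (lie c b).
Proof.
move=> Gb; elim: Gb n c => {m b}
  [m z [-> Yz]|m|m x y _ IHx _ IHy|m p x y _ IHx _ IHy|m p z mp _ IHz] n c Gc.
- by rewrite addn1; apply: spanB_lieY.
- by rewrite lie0r; apply: Lie_span0.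
- by rewrite lieBr; apply: Lie_spanB; [apply: IHx | apply: IHy].
- rewrite lie_jacobir; apply: Lie_spanB; first by rewrite addnA; apply/IHy/IHx.
  by rewrite (addnC m p) addnA; apply/IHx/IHy.
- by apply: (@Lie_span_le _ (n + m)); [rewrite leq_add2l | apply: IHz].
Qed.

Let lieYX y : Y y -> lie_span GB 2 (lie y X).
Proof. by move=> Yy; apply: Lie_span_gen; exists 0%N, y, [::]; split. Qed.

(** If [ys] is empty, the run of [X] grows by one. Otherwise [X] is moved inwards past the last [y]
    by the Jacobi identity; the correction contains [[y, X]], itself a generator. *)
Let spanB_lieX n c : lie_span GB n c -> lie_span GB n.+1 (lie c X).
Proof.
elim=> {n c} [n z|n|n a b _ Ga _ Gb|n m a b Ga GLa Gb GLb|n m z nm _].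
- move=> [k [y0 [ys [-> Yy0 Yys ->]]]] {n z};
    elim/last_ind: ys Yys => [|ys y IHys] Yys.
    rewrite cats0 -foldl_rcons addn0; apply: Lie_span_gen; exists k.+1, y0, [::].
    split=> //; last by rewrite addn0.
    by rewrite cats0; congr foldl; elim: (k.+1) => //= j ->.
  have Yy : Y y by apply: Yys; rewrite mem_rcons mem_head.
  have {}Yys z : z \in ys -> Y z by move=> zys; apply: Yys;
    rewrite mem_rcons inE zys orbT.
  rewrite -rcons_cat foldl_rcons lie_jacobil size_rcons addnS; apply: lie_spanD.
    by apply: spanB_lieY => //; apply: IHys.
  rewrite -addn2; apply: Lie_span_lie (lieYX Yy).
  by apply: Lie_span_gen; exists k, y0, ys.
- by rewrite lie0l; apply: Lie_span0.
- by rewrite lieBl; apply: Lie_spanB.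
- rewrite lie_jacobil; apply: lie_spanD; first by rewrite -addSn;
    apply: Lie_span_lie.
  by rewrite -addnS; apply: Lie_span_lie.
- by apply: Lie_span_le; rewrite ltnS.
Qed.

Let spanY_lieX n b : lie_span GY n b -> lie_span GB n.+1 (lie b X).
Proof.
elim=> {n b} [n z [-> Yz]|n|n a b _ Ga _ Gb|n m a b Ga GLa Gb GLb|n m z nm _].
- exact: lieYX.
- by rewrite lie0l; apply: Lie_span0.
- by rewrite lieBl; apply: Lie_spanB.
- rewrite lie_jacobil; apply: lie_spanD; first by rewrite -addSn;
    apply: spanB_spanY.
  rewrite -addnS addnC lie_anti; apply/lie_spanN; exact: spanB_spanY.
- by apply: Lie_span_le; rewrite ltnS.
Qed.

Let spanB_scaleX n m (i : int) b : (0 < n)%N \/ i = 0 ->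
  lie_span GB m.+1 (lie b X) -> lie_span GB (n + m) (i%:~R *: lie X b).
Proof.
case=> [n0|-> _]; last by rewrite scale0r; apply: Lie_span0.
move=> Gb; apply: (@Lie_span_le _ m.+1); first by rewrite -add1n leq_add2r.
by apply: lie_span_int; rewrite lie_anti; apply: lie_spanN.
Qed.

(** The span of [GB] absorbs brackets with [X] and with the span of [GY], and it receives [[b, X]]
    for [b] in the latter. The condition on [i] records that [X] has weight 1, which keeps the
    weights of the products under control. *)
Lemma lazard_elimination n z :
  lie_span (fun n z => n = 1%N /\ (z = X \/ Y z)) n z ->
  exists (i : int) b c, [/\ z = i%:~R *: X + b + c, (0 < n)%N \/ i = 0,
    lie_span GY n b & lie_span GB n c].
Proof.
elim=> {n z} [n z [-> [->|Yz]]|n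
  |n x y _ [i [b [c [-> i0 Gb Gc]]]] _ [j [b' [c' [-> j0 Gb' Gc']]]]
  |n m x y _ [i [b [c [-> i0 Gb Gc]]]] _ [j [b' [c' [-> j0 Gb' Gc']]]]
  |n m z nm _ [i [b [c [-> i0 Gb Gc]]]]].
- by exists 1, 0, 0; rewrite scale1r !addr0; split=> //;
    by [left | apply: Lie_span0].
- exists 0, z, 0; rewrite scale0r add0r addr0; split;
    [by []|by right| |exact: Lie_span0].
  exact: Lie_span_gen.
- by exists 0, 0, 0; rewrite scale0r !addr0; split=> //;
    by [right | apply: Lie_span0].
- exists (i - j), (b - b'), (c - c'); split; [| |exact: Lie_spanB..].
    by rewrite intrB scalerBl (opprD (_ + b')) addrACA opprD (addrACA _ b).
  by case: i0 j0 => [?|->] [?|->]; rewrite ?subrr; by [left | right].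
(* Of the nine terms of the product, [[X, X]] vanishes, [[b, b']] stays in the span of [GY], and the
   other seven fall into the span of [GB]. *)
- exists 0, (lie b b'), ((i%:~R *: lie X b' + i%:~R *: lie X c' +
     j%:~R *: lie b X + lie b c') + (j%:~R *: lie c X + lie c b' + lie c c'));
       split.
  + rewrite scale0r add0r !lieDl !lieDr !lieZl !lieZr liexx !scaler0 add0r.
    by rewrite (AC (2*3*3) (4*((1*2*3*5)*(6*7*8)))).
  + by right.
  + exact: Lie_span_lie.
  + have scaleX k p a : (0 < p)%N \/ j = 0 -> lie_span GB k.+1 (lie a X) ->
        lie_span GB (k + p) (j%:~R *: lie a X).
      move=> p0 Ga; rewrite lie_anti scalerN addnC; apply: lie_spanN.
      exact: spanB_scaleX.
    do ![apply: lie_spanD].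
    * exact/spanB_scaleX/spanY_lieX.
    * exact/spanB_scaleX/spanB_lieX.
    * exact/scaleX/spanY_lieX.
    * by rewrite lie_anti addnC; apply/lie_spanN/spanB_spanY.
    * exact/scaleX/spanB_lieX.
    * exact: spanB_spanY.
    * exact: Lie_span_lie.
- exists i, b, c; split=> //; [|exact: Lie_span_le nm _..].
  by case: i0 => [n0|]; [left; apply: leq_trans n0 nm | right].
Qed.

End Elimination.
End LieSpan.

(** * Integral spanning by configuration brackets *)

Section IntegralSpan.
Variables (K : fieldType) (L : lieAlgType K) (d : nat) (gen : 'I_d -> L).
Local Notation config := (config gen).
Implicit Types (n m : nat) (x y : word d) (z : L) (S : seq (word d)).

Definition config_int z : Prop := exists s : seq (int * lyndon_word d),
  z = \sum_(p <- s) p.1%:~R *: config (val p.2).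

Lemma config_int0 : config_int 0.
Proof. by exists [::]; rewrite big_nil. Qed.

Lemma config_intD z z' : config_int z -> config_int z' -> config_int (z + z').
Proof. by case=> s -> [s' ->]; exists (s ++ s'); rewrite big_cat. Qed.

Lemma config_int_lyndon x (i : int) : lyndon x -> config_int (i%:~R *: config x).
Proof.
by move=> xL; exists [:: (i, exist _ x xL : lyndon_word d)]; rewrite big_seq1.
Qed.

Definition letter_gen S n z : Prop := n = 1%N /\ exists2 y, y \in S & z = config y.

Lemma letter_gen_sub S S' n z : {subset S <= S'} ->
  lie_span (letter_gen S) n z -> lie_span (letter_gen S') n z.
Proof.
move=> SS'; apply: lie_span_sub => k a [-> [y yS ->]]; apply: Lie_span_gen.
by split=> //; exists y => //; apply: SS'.
Qed.

Lemma lie_span_eq0 (G : nat -> L -> Prop) n z :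
  (forall k a, (k <= n)%N -> G k a -> a = 0) -> lie_span G n z -> z = 0.
Proof.
move=> G0 Gz; elim: Gz G0 => {n z}
  [n z Gz|n|n a b _ IHa _ IHb|n m a b _ IHa _ _|n m z nm _ IHz] G0.
- exact: G0 Gz.
- by [].
- by rewrite IHa // IHb // subrr.
- by rewrite IHa ?lie0l // => k c kn; apply: G0;
    apply: leq_trans kn (leq_addr _ _).
- by apply: IHz => k a kn; apply: G0; apply: leq_trans nm.
Qed.

Lemma map_config_ex (P : word d -> Prop) (s : seq L) :
  (forall a, a \in s -> exists2 y, P y & a = config y) ->
  exists2 t, (forall y, y \in t -> P y) & s = map config t.
Proof.
elim: s => [|a s IHs] Ps; first by exists [::].
have [|t Pt ->] := IHs; first by move=> b bs; apply: Ps; rewrite inE bs orbT.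
have [y Py ->] := Ps a (mem_head _ _); exists (y :: t) => // y'.
by rewrite inE => /orP[/eqP ->|/Pt].
Qed.

(** Each generator is the configuration bracket of a simple word of at least two letters. As a
    letter of the next alphabet it gets weight 1, so the bound drops from [n] to [n.-1]. An element
    involves only finitely many of them, collected in [SS]. *)
Lemma lie_span_simple m S x n z :
  alphabet m S -> x \in S ->
  lie_span (fun n z => exists k a s,
    [/\ z = foldl lie a (nseq k.+1 (config x) ++ s),
        exists2 y, y \in S /\ y <> x & a = config y,
        forall b, b \in s -> exists2 y, y \in S /\ y <> x & b = config y
      & n = (k + size s).+2]) n z ->
  exists2 SS, (forall b, b \in SS -> simple_seq x b /\ {subset b <= S})
    & lie_span (letter_gen (map flatten SS)) n.-1 z.
Proof.
move=> alphS xS; elim=> {n z} [n z|n|n a b _ [SS simS Ga] _ [SS' simS' Gb]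
  |n p a b _ [SS simS Ga] _ [SS' simS' Gb]|n p z np _ [SS simS Gz]].
- move=> [k [_ [ys [-> [y [yS yx] ->] Pys ->]]]].
  have [t tP ->] := map_config_ex Pys.
  have bS : {subset nseq k.+1 x ++ y :: t <= S}.
    move=> w; rewrite mem_cat inE => /orP[|/orP[/eqP -> //|/tP[]//]].
    by rewrite mem_nseq => /andP[_ /eqP ->].
  have xyt : x \notin y :: t.
    by rewrite inE negb_or; apply/andP; split; apply/negP;
      [move/eqP=> /esym | case/tP].
  exists [:: nseq k.+1 x ++ y :: t].
    by move=> b; rewrite inE => /eqP ->; split=> //; exists k.+1, (y :: t).
  apply: (@Lie_span_le _ _ _ 1) => //; apply: Lie_span_gen; split=> //.
  exists (flatten (nseq k.+1 x ++ y :: t)); first by rewrite mem_head.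
  by rewrite (config_decomp gen (simple_decomp alphS bS _ _ xyt)).
- by exists [::] => //; apply: Lie_span0.
- exists (SS ++ SS'); first by move=> c; rewrite mem_cat => /orP[/simS|/simS'].
  by apply: Lie_spanB;
    [apply: letter_gen_sub Ga | apply: letter_gen_sub Gb] => y yS;
    rewrite map_cat mem_cat yS ?orbT.
- exists (SS ++ SS'); first by move=> c; rewrite mem_cat => /orP[/simS|/simS'].
  apply: (@Lie_span_le _ _ _ (n.-1 + p.-1)).
    by case: (n) => [|n']; rewrite ?add0n // addSn /= leq_add2l leq_pred.
  by apply: Lie_span_lie;
    [apply: letter_gen_sub Ga | apply: letter_gen_sub Gb] => y yS;
    rewrite map_cat mem_cat yS ?orbT.
- exists SS => //; apply: Lie_span_le Gz.
  by case: (n) (p) np => [|n'] [|p'].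
Qed.

(* Each elimination of a least letter either shrinks the alphabet or strictly
   decreases the weight, as the new letters have at least two old letters. *)
Lemma lie_span_config_int n m S z : alphabet m S ->
  lie_span (letter_gen S) n z -> config_int z.
Proof.
elim: n m S z => [|n IHn] m S z alphS.
  (* All generators have weight 1, so only 0 has weight 0. *)
  move=> Gz; rewrite (lie_span_eq0 _ Gz); first exact: config_int0.
  by move=> k a k0 [k1]; rewrite k1 in k0.
have [N] := ubnP (size S); elim: N S alphS z => // N IHN S alphS z SN Gz.
have [S0|/eqP S0] := eqVneq S [::].
  rewrite (lie_span_eq0 _ Gz); first exact: config_int0.
  by move=> k a _ [_ [y]]; rewrite S0.
have [x xleast] := least_letter_ex S0; have [xS xmin] := xleast.
pose Y z := exists2 y, y \in S /\ y <> x & z = config y.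
have [|i [b [c [-> _ Gb Gc]]]] := @lazard_elimination _ _ (config x) Y n.+1 z.
  apply: lie_span_sub Gz => k a [-> [y yS ->]]; apply: Lie_span_gen; split=> //.
  by have [->|/eqP yx] := eqVneq y x; [left | right; exists y].
have [_ lynS _] := alphS.
apply: config_intD; first apply: config_intD.
- exact/config_int_lyndon/lynS.
- have subS : {subset [seq y <- S | y != x] <= S} by move=> y;
    rewrite mem_filter => /andP[].
  apply: (IHN _ (alphabet_sub subS alphS)).
    rewrite size_filter; apply: (@leq_trans (size S)); last exact: SN.
    rewrite -(count_predC (pred1 x)).
    by rewrite -[X in (X < _)%N]add0n ltn_add2r -has_count has_pred1.
  apply: lie_span_sub Gb => k a [-> [y [yS yx] ->]]; apply: Lie_span_gen;
    split=> //.
  by exists y; rewrite // mem_filter yS andbT; apply/eqP.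
- have [SS simS Gc'] := lie_span_simple alphS xS Gc.
  exact: (IHn m.+1 _ _ (alphabet_simple alphS xleast simS)).
Qed.

Lemma eval_expr_config_int (e : bracket_expr d) : config_int (eval_expr gen e).
Proof.
suff [n] : exists n,
    lie_span (letter_gen [seq [:: i] | i <- enum 'I_d]) n (eval_expr gen e).
  exact/lie_span_config_int/alphabet_letters.
elim: e => [i|e1 [n1 G1] e2 [n2 G2]] /=; last by exists (n1 + n2)%N;
  apply: Lie_span_lie.
exists 1%N; apply: Lie_span_gen; split=> //.
by exists [:: i]; rewrite ?config_letter // map_f ?mem_enum.
Qed.

End IntegralSpan.

(** * Leading words *)

Section MatrixLie.
Variables (K : fieldType) (n : nat).
Implicit Types A B C : 'M[K]_n.

Definition mx_lie A B : 'M[K]_n := A *m B - B *m A.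

Lemma mx_lie_linearl B : linear (fun A => mx_lie A B).
Proof.
move=> k A A'; rewrite /mx_lie mulmxDl mulmxDr -scalemxAl -scalemxAr.
by rewrite scalerBr opprD addrACA.
Qed.

Lemma mx_lie_linearr A : linear (mx_lie A).
Proof.
move=> k B B'; rewrite /mx_lie mulmxDl mulmxDr -scalemxAl -scalemxAr.
by rewrite scalerBr opprD addrACA.
Qed.

Lemma mx_liexx A : mx_lie A A = 0.
Proof. exact: subrr. Qed.

Lemma mx_lie_jacobi A B C :
  mx_lie A (mx_lie B C) + mx_lie B (mx_lie C A) + mx_lie C (mx_lie A B) = 0.
Proof.
rewrite /mx_lie !mulmxBr !mulmxBl !opprB !mulmxA.
set a := A *m B *m C; set b := A *m C *m B; set c := B *m C *m A.
set a' := C *m B *m A; set b' := B *m A *m C; set c' := C *m A *m B.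
(* The twelve products are rearranged into six cancelling pairs. *)
rewrite (AC ((2*2)*(2*2)*(2*2)) ((1*12)*(7*2)*(3*10)*(5*4)*(11*6)*(9*8))).
by rewrite /= !subrr !addr0.
Qed.

HB.instance Definition _ := Lmodule_isLie.Build K 'M[K]_n
  mx_lie_linearl mx_lie_linearr mx_liexx mx_lie_jacobi.

Lemma lie_mxE A B : lie A B = A *m B - B *m A.
Proof. by []. Qed.

End MatrixLie.

Section LeadingWord.
Variables (K : fieldType) (n d : nat) (E : 'I_d -> 'M[K]_n).
Implicit Types (u v w x y : word d) (A B : 'M[K]_n).

Definition mx_word u : 'M[K]_n := foldr (fun i => mulmx (E i)) 1%:M u.

Lemma mx_word_cat u v : mx_word (u ++ v) = mx_word u *m mx_word v.
Proof. by elim: u => /= [|i u ->]; rewrite ?mul1mx ?mulmxA. Qed.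

Definition word_span (P : word d -> Prop) A : Prop :=
  exists2 s : seq (K * word d), (forall p, p \in s -> P p.2)
    & A = \sum_(p <- s) p.1 *: mx_word p.2.

Lemma word_span_sub P Q A : (forall u, P u -> Q u) -> word_span P A ->
  word_span Q A.
Proof. by move=> PQ [s Ps ->]; exists s => // p /Ps/PQ. Qed.

Lemma word_spanD P A B : word_span P A -> word_span P B -> word_span P (A + B).
Proof.
case=> s Ps -> [s' Ps' ->]; exists (s ++ s'); last by rewrite big_cat.
by move=> p; rewrite mem_cat => /orP[/Ps|/Ps'].
Qed.

Lemma word_spanZ P k A : word_span P A -> word_span P (k *: A).
Proof.
case=> s Ps ->; exists [seq (k * p.1, p.2) | p <- s].
  by move=> _ /mapP[p /Ps Pp ->].
by rewrite big_map scaler_sumr; apply: eq_bigr => p _; rewrite scalerA.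
Qed.

Lemma word_span1 (P : word d -> Prop) u : P u -> word_span P (mx_word u).
Proof.
move=> Pu; exists [:: (1, u)]; last by rewrite big_seq1 scale1r.
by move=> p; rewrite inE => /eqP ->.
Qed.

Lemma word_spanM (P Q R : word d -> Prop) A B :
  (forall u v, P u -> Q v -> R (u ++ v)) ->
  word_span P A -> word_span Q B -> word_span R (A *m B).
Proof.
move=> PQR [s Ps ->] [s' Qs' ->].
exists [seq (p.1 * q.1, p.2 ++ q.2) | p <- s, q <- s'].
  by move=> _ /allpairsP[[p q] [/= /Ps ? /Qs' ? ->]]; apply: PQR.
rewrite big_allpairs_dep mulmx_suml; apply: eq_bigr => p _.
rewrite mulmx_sumr; apply: eq_bigr => q _.
by rewrite -scalemxAl -scalemxAr scalerA mx_word_cat.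
Qed.

(** Equal lengths make the comparison stable under appending words on the right. *)
Definition above u v : Prop := size v = size u /\ lex_lt u v.

(** Only the existence of such an expansion is asserted: for general [E] the products [mx_word] may
    be linearly dependent. *)
Definition leading_word u A : Prop :=
  exists2 k, k != 0 & word_span (above u) (A - k *: mx_word u).

Lemma leading_wordM u v A B :
  leading_word u A -> leading_word v B -> leading_word (u ++ v) (A *m B).
Proof.
move=> [k k0 spA] [l l0 spB]; exists (k * l); first by rewrite mulf_neq0.
set A' := A - _ in spA; set B' := B - _ in spB.
(* The error splits into three products, each with at least one factor made of larger words. *)
have -> : A *m B - (k * l) *: mx_word (u ++ v) =
    k *: mx_word u *m B' + A' *m (l *: mx_word v) + A' *m B'.
  rewrite -addrA -mulmxDr [l *: _ + _]addrC subrK mulmxBl mulmxBr addrC addrA subrK.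
  by rewrite -scalemxAl -scalemxAr scalerA -mx_word_cat.
have span1 (w : word d) a : word_span (eq w) (a *: mx_word w).
  exact/word_spanZ/word_span1.
do ![apply: word_spanD].
- apply: word_spanM (span1 u k) spB => _ v' <- [szv vv'].
  by rewrite /above !size_cat szv lex_lt_cat2l.
- apply: word_spanM spA (span1 v l) => u' _ [szu uu'] <-.
  by rewrite /above !size_cat szu lex_lt_catr ?szu.
- apply: word_spanM spA spB => u' v' [szu uu'] [szv vv'].
  by rewrite /above !size_cat szu szv lex_lt_catr ?szu.
Qed.

Lemma leading_word_above u v A : above u v -> leading_word v A ->
  word_span (above u) A.
Proof.
move=> [szv uv] [k k0 spA]; rewrite -[A](subrK (k *: mx_word v)).
apply: word_spanD; last exact/word_spanZ/word_span1.
apply: word_span_sub spA => w [szw vw].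
by split; [rewrite szw | apply: lex_lt_trans vw].
Qed.

Lemma leading_word_lie u v A B :
  leading_word u A -> leading_word v B -> lex_lt (u ++ v) (v ++ u) ->
  leading_word (u ++ v) (lie A B).
Proof.
move=> luA lvB uv; have [k k0 spAB] := leading_wordM luA lvB; exists k => //.
rewrite lie_mxE addrAC; apply: word_spanD => //; rewrite -scaleN1r;
  apply: word_spanZ.
apply: leading_word_above (leading_wordM lvB luA).
by rewrite /above !size_cat addnC.
Qed.

Lemma leading_word_lieC u v A B :
  leading_word u A -> leading_word v B -> lex_lt (v ++ u) (u ++ v) ->
  leading_word (v ++ u) (lie A B).
Proof.
move=> luA lvB vu; have [k k0 spBA] := leading_word_lie lvB luA vu.
exists (- k); first by rewrite oppr_eq0.
rewrite lie_anti scaleNr -opprD -[- (_ - _)]scaleN1r; exact: word_spanZ.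
Qed.

Local Notation config := (config E).

(** The left-normed bracket is followed factor by factor: a factor [x] attaches to the leading word
    on the left, a later letter [z] on the right, since these are the smaller of the two
    products. *)
Lemma leading_word_simple m S x b : alphabet m S -> least_letter S x ->
  {subset b <= S} -> simple_seq x b ->
  (forall y, y \in S -> leading_word y (config y)) ->
  leading_word (flatten b) (config (flatten b)).
Proof.
move=> alphS xleast bS simb leadS.
have [xS xmin] := xleast; have [_ _ sepS] := alphS.
have [k [[|y ys] [def_b k0 // ys0 xys]]] := simb; rewrite {}def_b in bS *.
rewrite (config_decomp E (simple_decomp alphS bS k0 ys0 xys)).
have ysS z : z \in y :: ys -> [/\ z \in S & lex_lt x z].
  move=> zys; have zS : z \in S by apply: bS; rewrite mem_cat zys orbT.
  by split=> //; apply: xmin => // zx; rewrite -zx zys in xys.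
elim/last_ind: ys bS {ys0 xys simb} ysS => [|ys z IHys] bS ysS.
  have [yS xy] := ysS y (mem_head _ _).
  rewrite cats0 flatten_cat /= cats0; elim: (k) => [|j IHj]; first exact: leadS.
  have nseqSr (T : Type) (a : T) i : nseq i.+1 a = rcons (nseq i a) a.
    by elim: i => //= i ->.
  rewrite (nseqSr _ (config x)) foldl_rcons /= -catA.
  apply: leading_word_lieC IHj (leadS x xS) _.
  (* After cancelling the common prefix of [j] copies of [x], it remains to compare [xy] with
     [yx]. *)
  have -> : x ++ flatten (nseq j x) ++ y = flatten (nseq j x) ++ x ++ y.
    by rewrite catA -[x ++ _]/(flatten (nseq j.+1 x)) nseqSr flatten_rcons catA.
  have flat_y : flatten [:: y] = y by rewrite /= cats0.
  rewrite -catA lex_lt_cat2l -{1}flat_y; apply: sepS => // w.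
  by rewrite inE => /eqP ->.
have [zS xz] := ysS z ltac:(by rewrite inE mem_rcons mem_head orbT).
have {}bS : {subset nseq k x ++ y :: ys <= S}.
  move=> w wb; apply: bS; move: wb; rewrite !mem_cat !inE mem_rcons inE.
  by case/or3P=> ->; rewrite ?orbT.
have {}ysS w : w \in y :: ys -> w \in S /\ lex_lt x w.
  by move=> wys; have [] := ysS w;
    rewrite // inE mem_rcons inE orbCA -in_cons wys orbT.
rewrite map_rcons -rcons_cat foldl_rcons -rcons_cons -rcons_cat flatten_rcons.
apply: leading_word_lie (leadS z zS) _; first by apply: IHys => // w /ysS[].
case: k k0 bS {IHys} => // k _ bS.
rewrite [flatten _]/= -!catA -flatten_rcons; apply: sepS => //.
by move=> w; rewrite mem_rcons inE => /orP[/eqP ->|wb] //; apply: bS;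
  rewrite inE wb orbT.
Qed.

(** Letters are added at the front: a letter other than [x] joins [ys], and [x] either closes a
    nonempty [ys] into a new block or lengthens the run of the first block. *)
Lemma simple_parse (T : eqType) (x : T) (s : seq T) : last x s <> x ->
  exists ys SS, [/\ s = ys ++ flatten SS, x \notin ys
    & forall b, b \in SS -> simple_seq x b].
Proof.
case: s => // z s; elim: s z => [|z' s IHs] z /= lastx.
  by exists [:: z], [::]; split=> //; rewrite inE; apply/eqP => /esym.
have [ys [SS [eq_s xys simSS]]] := IHs z' lastx.
have [<-{z}|/eqP xz] := eqVneq x z; last first.
  by exists (z :: ys), SS; split=> //=;
    [rewrite eq_s | rewrite inE negb_or xys andbT; apply/eqP].
case: ys xys eq_s => [|y ys] xys eq_s.
  case: SS simSS eq_s => [|b SS] simSS eq_s; first by [].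
  exists [::], ((x :: b) :: SS); split=> //; first by rewrite eq_s.
  move=> c; rewrite inE => /orP[/eqP ->|cS]; last by apply: simSS;
    rewrite inE cS orbT.
  have [k [ys [-> k0 ys0 xys']]] := simSS b (mem_head _ _).
  by exists k.+1, ys.
exists [::], ((x :: y :: ys) :: SS); split=> //; first by rewrite eq_s.
by move=> c; rewrite inE => /orP[/eqP ->|/simSS //]; exists 1%N, (y :: ys).
Qed.

(** Induction on the number of letters: a Lyndon word with more than one letter splits entirely into
    simple words over [S], which form a shorter sequence over the next alphabet. *)
Lemma leading_word_flatten m S : alphabet m S -> lyndon (flatten S) ->
  (forall y, y \in S -> leading_word y (config y)) ->
  leading_word (flatten S) (config (flatten S)).
Proof.
have [N] := ubnP (size S); elim: N m S => // N IHN m [|x S] // SN alphS wL leadS.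
have [S0|/eqP S0] := eqVneq S [::].
  by rewrite S0 /= cats0; apply: leadS; rewrite mem_head.
have [_ lynS sepS] := alphS; have xS := mem_head x S.
have xleast : least_letter (x :: S) x.
  split=> // y; rewrite inE => /orP[/eqP //|yS] yx.
  have [xy|xy|y_lt_x] := lex_lt_total x y; [exact: xy | by rewrite xy in yx |].
  have yS' : y \in x :: S by rewrite inE yS orbT.
  have [S1 [S2 def_S]] : exists S1 S2, S = S1 ++ y :: S2.
    by case/splitPr: yS => S1 S2; exists S1, S2.
  (* A letter smaller than the first one would start a smaller rotation. *)
  have /lyndonP[_ wP] := wL.
  have := wP (flatten (x :: S1)) (flatten (y :: S2)).
  have flat0 z s : z \in x :: S -> flatten (z :: s) <> [::].
    by move=> /lynS/lyndon_neq0; case: (z).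
  rewrite -flatten_cat def_S => /(_ (flat0 _ _ xS) (flat0 _ _ yS') erefl).
  rewrite -flatten_cat lex_lt_gtF //=; apply: sepS => // z.
  rewrite mem_cat inE => zS; rewrite inE def_S mem_cat inE.
  by move: zS; case: (z == x); case: (z \in S1); case: (z \in S2); rewrite ?orbT.
have x0 := lyndon_neq0 (lynS x xS).
(* A last letter equal to [x] would make [x] a border of a Lyndon word. *)
have lastx : last x (x :: S) <> x.
  case/lastP: S S0 {SN alphS leadS lynS sepS xS xleast} wL => // S z _.
  rewrite /= last_rcons flatten_rcons => wL zx.
  by rewrite zx lyndon_unbordered in wL.
have [ys [SS [eq_S xys simSS]]] := simple_parse lastx.
(* The sequence starts with [x], so nothing precedes the first block. *)
have {xys} ys0 : ys = [::].
  by case: ys xys eq_S => // y ys xys [eq_x]; rewrite eq_x mem_head in xys.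
rewrite {ys}ys0 /= in eq_S.
have subS b : b \in SS -> {subset b <= x :: S}.
  by move=> bSS y yb; rewrite eq_S; apply/flattenP; exists b.
have SS0 : SS <> [::] by move=> SS0; rewrite SS0 in eq_S.
rewrite eq_S flatten_flatten in wL *; apply: (IHN m.+1) => //.
- rewrite size_map -ltnS; apply: leq_trans SN; rewrite ltnS eq_S.
  apply: leq_trans (size_flatten_simple simSS).
  by case: (SS) SS0 => //= ? ? _; rewrite addSn ltnS leq_addl.
- by apply: alphabet_simple alphS xleast _ => b bSS; split;
    [apply: simSS | apply: subS].
- move=> _ /mapP[b bSS ->].
  exact: (leading_word_simple alphS xleast (subS b bSS) (simSS b bSS) leadS).
Qed.

Lemma leading_word_lyndon w : lyndon w -> leading_word w (config w).
Proof.
move=> wL; rewrite -(flatten_seq1 w); apply: (@leading_word_flatten 0).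
- apply: alphabet_sub (@alphabet_letters d) => _ /mapP[i _ ->].
  by rewrite map_f ?mem_enum.
- by rewrite flatten_seq1.
move=> _ /mapP[i _ ->]; exists 1; first exact: oner_neq0.
rewrite config_letter scale1r /= mulmx1 subrr.
by exists [::] => //; rewrite big_nil.
Qed.

End LeadingWord.

(** * Linear independence of the configuration brackets in matrices *)

Section Independence.
Variables (K : fieldType) (d N : nat).
Local Notation short_word := (N.-bseq 'I_d).

(* Right multiplication by the letter [i] on the words of length at most [N],
   acting on row vectors. *)
Definition letter_mx (i : 'I_d) : 'M[K]_#|{: short_word}| :=
  \matrix_(a, b) (val (enum_val b) == rcons (val (enum_val a)) i)%:R.

(** The length bound keeps all intermediate words in the index set, so a single intermediate index
    [c] contributes to each matrix product. *)
Lemma mx_wordE (u : word d) a b : (size (val (enum_val a)) + size u <= N)%N ->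
  mx_word letter_mx u a b = (val (enum_val b) == val (enum_val a) ++ u)%:R.
Proof.
elim: u a => [|i u IHu] a /= szu.
  by rewrite mxE cats0 (inj_eq val_inj) (inj_eq enum_val_inj) eq_sym.
have szai : (size (rcons (val (enum_val a)) i) <= N)%N.
  by rewrite size_rcons; apply: leq_trans szu; rewrite addnS ltnS leq_addr.
pose c := enum_rank (Bseq szai : short_word).
have val_c : val (enum_val c) = rcons (val (enum_val a)) i by rewrite enum_rankK.
rewrite mxE (bigD1 c) //= big1 => [|c' c'c].
  rewrite addr0 mxE val_c eqxx mul1r IHu val_c ?cat_rcons //.
  by rewrite size_rcons addSnnS.
rewrite mxE; case: eqP => [eq_c'|_]; last by rewrite mul0r.
by case/eqP: c'c; apply/enum_val_inj/val_inj; rewrite val_c.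
Qed.

(** In the row of the empty word, the column of [w] reads off the coefficient of [w]; this is where
    distinct words become independent. *)
Lemma leading_word_coef (u w : word d) (A : 'M[K]_#|{: short_word}|) a b :
  val (enum_val a) = [::] -> val (enum_val b) = w -> (size w <= N)%N ->
    (size u <= N)%N ->
  leading_word letter_mx u A ->
  (u = w -> A a b != 0) /\ (lex_lt w u -> A a b = 0).
Proof.
move=> def_a def_b szw szu [k k0 [s us eqA]].
have coefE v : (size v <= N)%N -> mx_word letter_mx v a b = (w == v)%:R.
  by move=> szv; rewrite mx_wordE def_a ?add0n // def_b.
have tail0 : u = w \/ lex_lt w u -> (A - k *: mx_word letter_mx u) a b = 0.
  move=> wu; rewrite eqA summxE big_seq big1 // => p /us[szp up].
  rewrite mxE coefE ?szp //; case: eqP => [wp|]; last by rewrite mulr0.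
  rewrite -wp in up; case: wu => [uw|wu]; first by rewrite uw lex_ltxx in up.
  by rewrite (lex_lt_gtF wu) in up.
split=> wu; have := tail0 (ltac:(by [left | right])); rewrite !mxE coefE //.
  by rewrite wu eqxx mulr1 => /eqP; rewrite subr_eq0 => /eqP ->.
by case: eqP wu => [->|_ _]; rewrite ?lex_ltxx // mulr0 subr0.
Qed.

(** Triangularity: at the least word [u] with nonzero coefficient, brackets of larger words have
    entry 0, so only the term of [u] survives. *)
Lemma config_mx_free (s : seq (lyndon_word d)) (c : lyndon_word d -> K) :
  uniq s -> (forall v : lyndon_word d, v \in s -> size (val v) <= N)%N ->
  \sum_(w <- s) c w *: config letter_mx (val w) = 0 ->
  forall w : lyndon_word d, w \in s -> c w = 0.
Proof.
move=> s_uniq szs sum0 w ws; apply/eqP/negPn/negP => cw.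
pose s0 := [seq val v | v <- s & c v != 0].
have [|x [/mapP[u]]] := @least_letter_ex _ s0.
  have : val w \in s0 by rewrite map_f // mem_filter cw.
  by case: s0.
rewrite mem_filter => /andP[cu us] -> umin {x}.
pose a := enum_rank ([bseq] : short_word).
pose b := enum_rank (Bseq (szs u us) : short_word).
have coefP v : v \in s -> (v = u -> config letter_mx (val v) a b != 0) /\
    (lex_lt (val u) (val v) -> config letter_mx (val v) a b = 0).
  move=> vs; have [|||||c1 c2] := @leading_word_coef (val v) (val u)
    (config letter_mx (val v)) a b.
  - by rewrite enum_rankK.
  - by rewrite enum_rankK.
  - exact: (szs u us).
  - exact: (szs v vs).
  - exact/leading_word_lyndon/(valP v).
  by split=> [vu|//]; apply: c1; rewrite vu.
move/matrixP/(_ a b): sum0;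
  rewrite summxE (bigD1_seq u) //= big1_seq => [|v /andP[vu vs]].
  by rewrite !mxE addr0 => /eqP;
    rewrite mulf_eq0 (negPf cu) (negPf ((coefP u us).1 erefl)).
rewrite mxE; have [->|cv] := eqVneq (c v) 0; first by rewrite mul0r.
rewrite (coefP v vs).2 ?mulr0 //; apply: umin;
  first by rewrite map_f // mem_filter cv.
by move/val_inj/eqP; apply/negP.
Qed.

End Independence.

(** * Integer coefficients, and uniqueness in the free Lie algebra *)

Lemma config_morph (K : fieldType) (L M : lieAlgType K) (g : {linear L -> M})
    (d : nat) (gen : 'I_d -> L) (w : word d) :
  lie_morphism g -> g (config gen w) = config (g \o gen) w.
Proof.
move=> gM; rewrite /config.
have g_foldl z s : g (foldl lie z s) = foldl lie (g z) (map g s).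
  by elim: s z => //= y s IHs z; rewrite IHs gM.
(* Levels and decompositions depend on the word only, so both sides follow the same recursion. *)
move: (level w) => m; elim: m w => [|m IHm] w /=; first by case: w => *;
  rewrite ?linear0.
case: (decomposition m w) => [[x k] [|y ys]]; first by rewrite linear0.
rewrite g_foldl map_cat map_nseq !IHm -map_comp.
by congr (foldl _ _ (_ ++ _)); apply: eq_map => z; apply: IHm.
Qed.

Lemma config_comb_fsubset (K : fieldType) (L : lieAlgType K) (d : nat)
    (gen : 'I_d -> L) (c : {fsfun lyndon_word d ->
      K with 0}) (D : {fset lyndon_word d}) :
  (finsupp c `<=` D)%fset ->
  config_comb gen c = \sum_(w <- D) c w *: config gen (val w).
Proof.
move=> cD; rewrite /config_comb; apply: big_fset_incl => // w _ wc.
by rewrite fsfun_dflt // scale0r.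
Qed.


Lemma config_int_comb (K : fieldType) (L : lieAlgType K) (d : nat)
    (gen : 'I_d -> L) (z : L) : config_int gen z ->
  exists2 c : {fsfun lyndon_word d -> K with 0},
    z = config_comb gen c & forall w, exists n : int, c w = n%:~R.
Proof.
case=> s ->; pose D := [fset w in [seq p.2 | p <- s]]%fset.
(* A Lyndon word may occur several times in [s]; its integers are added before being sent to [K]. *)
pose a (w : lyndon_word d) : int := \sum_(p <- s | p.2 == w) p.1.
pose c : {fsfun lyndon_word d -> K with 0} := [fsfun w in D => (a w)%:~R].
exists c => [|w]; last first.
  by rewrite fsfunE; case: ifP => _; [exists (a w) | exists 0].
rewrite (@config_comb_fsubset _ _ _ _ _ D); last first.
  apply/fsubsetP => w; rewrite mem_finsupp fsfunE; case: ifP => //.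
  by rewrite eqxx.
have -> : \sum_(w <- D) c w *: config gen (val w) =
    \sum_(w <- D) \sum_(p <- s | p.2 == w) p.1%:~R *: config gen (val p.2).
  rewrite !big_seq; apply: eq_bigr => w wD; rewrite fsfunE wD /a.
  rewrite rmorph_sum scaler_suml.
  by apply: eq_bigr => p /eqP ->.
under [RHS]eq_bigr do rewrite big_mkcond.
rewrite exchange_big /= !big_seq; apply: eq_bigr => p ps.
have pD : p.2 \in D by rewrite inE map_f.
by rewrite (bigD1_seq p.2) ?fset_uniq //= eqxx big1 ?addr0 // => w /negPf;
  rewrite eq_sym => ->.
Qed.

Section FreeLie.
Variables (K : fieldType) (V : vectType K) (d : nat) (v : d.-tuple V).
Hypothesis v_basis : basis_of fullv v.
Variables (LV : lieAlgType K) (iota : {linear V -> LV}).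
Hypothesis LV_free : is_free_lie iota.
Let gen i := iota (tnth v i).

(** Coordinates in the basis [v] turn [f] into a linear map on [V], to which the universal property
    applies. *)
Lemma free_lie_morphism (M : lieAlgType K) (f : 'I_d -> M) :
  exists2 g : {linear LV -> M}, lie_morphism g & forall i, g (gen i) = f i.
Proof.
pose f_lin (x : V) : M := \sum_(i < d) coord v i x *: f i.
have f_linP : linear f_lin.
  move=> k x y; rewrite scaler_sumr -big_split; apply: eq_bigr => i _ /=.
  by rewrite linearP scalerDl scalerA.
pose f_pack := HB.pack_for {linear V ->
  M} f_lin (GRing.isLinear.Build _ _ _ _ f_lin f_linP).
have [g [gM gf _]] := LV_free f_pack; exists g => // i.
rewrite /gen gf /= /f_lin (bigD1 i) //= big1 => [|j ji].
  by rewrite (tnth_nth 0) coord_free ?(basis_free v_basis) // eqxx scale1r addr0.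
by rewrite (tnth_nth 0) coord_free ?(basis_free v_basis) // eq_sym (negPf ji) scale0r.
Qed.

Lemma config_comb_inj (c c' : {fsfun lyndon_word d -> K with 0}) :
  config_comb gen c = config_comb gen c' -> c = c'.
Proof.
pose D := (finsupp c `|` finsupp c')%fset.
rewrite !(@config_comb_fsubset _ _ _ _ _ D) ?fsubsetUl ?fsubsetUr //.
move/eqP; rewrite -subr_eq0 -sumrB => /eqP sum0.
(* Only the finitely many words of [D] matter, so matrices indexed by words of length at most [N]
   detect the relation. *)
pose N := \max_(w <- D) size (val w).
have [g gM g_gen] := free_lie_morphism (@letter_mx K d N).
have c_eq w : w \in D -> c w - c' w = 0.
  apply: (@config_mx_free K d N D (fun w => c w - c' w)) => //.
  - exact: fset_uniq.
  - by move=> u uD; apply: (@leq_bigmax_seq _ _ xpredT (fun w => size (val w))).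
  - have -> : @letter_mx K d N = g \o gen.
      by apply/funext => i; rewrite /= g_gen.
    rewrite -[RHS](linear0 g) -sum0 linear_sum; apply: eq_bigr => u _.
    by rewrite -scalerBl linearZ config_morph.
apply/fsfunP => w; have [/c_eq/eqP|] := boolP (w \in D).
  by rewrite subr_eq0 => /eqP.
by rewrite inE negb_or => /andP[wc wc']; rewrite !fsfun_dflt.
Qed.

End FreeLie.

Theorem corollary4p4 (K : fieldType) (V : vectType K) (d : nat)
    (v : d.-tuple V) (v_basis : basis_of fullv v)
    (LV : lieAlgType K) (iota : {linear V -> LV}) (LV_free : is_free_lie iota)
    (e : bracket_expr d) :
  let gen := fun i : 'I_d => iota (tnth v i) in
  exists c : {fsfun lyndon_word d -> K with 0},
    [/\ eval_expr gen e = config_comb gen c,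
        forall c' : {fsfun lyndon_word d -> K with 0},
          eval_expr gen e = config_comb gen c' -> c' = c
      & forall w : lyndon_word d, exists n : int, c w = n%:~R].
Proof.
move=> gen; have [c eval_c c_int] := config_int_comb (eval_expr_config_int gen e).
exists c; split=> // c' eval_c'.
by apply: (config_comb_inj v_basis LV_free); rewrite -eval_c -eval_c'.
Qed.
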